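(* Let $f$ be a field of characteristic $0$, let $L$ be a Lie algebra over $f$, and let $T$ be a strictly triangular representation of $L$ in a finite dimensional $f$-space $E$ with linearly ordered basis $(e_i)_{i\in I}$. An element $x\in E$ is a normal form on its $\Gamma(T)$-orbit if and only if $$x\preceq x+T(l)x$$ for all $l\in L$.
   Context: For $x\in E$ write $x=\sum_{i\in I}x_ie_i$. The representation $T$ is called strictly triangular if for all $l\in L$ the matrix of $T(l)$ in the ordered basis $(e_i)_{i\in I}$ is strictly lower triangular, i.e. $T(l)e_i$ is a linear combination of the $e_j$ with $j>i$. $\Gamma(T)$ denotes the group of automorphisms of $E$ of the form $\exp T(l)=\sum_{i\ge 0}\frac{1}{i!}T(l)^i$ with $l\in L$. The quasi-ordering $\preceq$ on $E$ is defined by: $x\preceq y$ iff for every $j\in I$ with $x_j\neq 0$ and $y_j=0$ there exists $i\le j$ with $x_i=0$ and $y_i\neq 0$. Write $x\prec y$ iff $x\preceq y$ and $y\not\preceq x$. The normal form of a $\Gamma(T)$-orbit is its lowest point, i.e. the point $x$ of the orbit such that $x\prec y$ for every $y\neq x$ in the orbit. *)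

(* Defs.v *)
From HB Require Import structures.
From mathcomp Require Import all_boot all_order all_algebra.
From mathcomp Require Import boolp classical_sets fsbigop.

Set Implicit Arguments.
Unset Strict Implicit.
Unset Printing Implicit Defensive.

Import GRing.Theory.

Local Open Scope classical_set_scope.
Local Open Scope ring_scope.

HB.mixin Record Lmodule_isLieAlgebra (F : fieldType) L & GRing.Lmodule F L := {
  lie_bracket : L -> L -> L;
  lie_linearl : forall z : L, linear (fun x => lie_bracket x z);
  lie_linearr : forall z : L, linear (lie_bracket z);
  lie_alternating : forall x : L, lie_bracket x x = 0;
  lie_jacobi : forall x y z : L,
    lie_bracket x (lie_bracket y z) + lie_bracket y (lie_bracket z x)
      + lie_bracket z (lie_bracket x y) = 0
}.

#[short(type="lieAlgType")]
HB.structure Definition LieAlgebra (F : fieldType) :=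
  {L of Lmodule_isLieAlgebra F L & GRing.Lmodule F L}.

Section LieRepresentation.
Variables (F : fieldType) (L : lieAlgType F) (E : vectType F).
Implicit Types (T : {linear L -> 'End(E)}) (u : 'End(E)) (x y : E).

Definition lie_representation T : Prop :=
  forall l m : L, T (lie_bracket l m) = (T l \o T m - T m \o T l)%VF.

(* ['End(E)] has no ring structure when [E] is the zero space, whence the
   explicit powers. *)
Definition lfun_pow u (i : nat) : 'End(E) := iter i (comp_lfun u) \1%VF.

(* A sum over all of [nat] is the sum of the nonzero terms, with junk value 0
   when there are infinitely many. This is the exponential series for nilpotent
   [u], in particular for the images of a strictly triangular representation. *)
Definition lfun_exp u : 'End(E) :=
  \sum_(i \in [set: nat]) ((i`!)%:R^-1 *: lfun_pow u i).

Definition Gamma T : set 'End(E) := [set lfun_exp (T l) | l in [set: L]].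

Definition Gamma_orbit T x : set E := [set (g : 'End(E)) x | g in Gamma T].

Section OrderedBasis.
(* The linearly ordered index set is ['I_n]; [e] is meant to be a basis, so
   that [coord e i x] is the [i]-th coordinate of [x]. *)
Variables (n : nat) (e : n.-tuple E).

(* [drop i.+1 e] lists the [e`_j] with [j > i]. *)
Definition strictly_triangular T : Prop :=
  forall (l : L) (i : 'I_n), T l e`_i \in <<drop i.+1 e>>%VS.

Definition preceq x y : Prop :=
  forall j : 'I_n, coord e j x != 0 -> coord e j y = 0 ->
    exists i : 'I_n, [/\ (i <= j)%N, coord e i x = 0 & coord e i y != 0].

Definition prec x y : Prop := preceq x y /\ ~ preceq y x.

Definition normal_form (O : set E) x : Prop :=
  O x /\ forall y, O y -> y <> x -> prec x y.

End OrderedBasis.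
End LieRepresentation.

(* Main.v *)
Require Import Defs.
From HB Require Import structures.
From mathcomp Require Import all_boot all_order all_algebra.
From mathcomp Require Import boolp classical_sets fsbigop.

Import GRing.Theory.
Local Open Scope ring_scope.

(** If [k] is the index of the first nonzero coordinate of [T l x], then
    [T l ^ m x] has zero coordinates up to [k] for all [m >= 2]. So [exp (T l) x]
    and [x + T l x] agree up to [k], and only there do they start to differ
    from [x]. Replacing [l] by a multiple, the [k]-th coordinate can be made to
    vanish if [x] has a nonzero one. Hence both sides of the equivalence say
    that [x] vanishes at the leading index of every nonzero [T l x]. *)

Section Coordinates.
Set Implicit Arguments.
Unset Strict Implicit.
Context {F : fieldType} {E : vectType F} {n : nat} (e : n.-tuple E).
Implicit Types (u v x y : E) (k : nat).

Definition vanish_below k v := forall i : 'I_n, (i < k)%N -> coord e i v = 0.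

Definition leads (i : 'I_n) v := coord e i v != 0 /\ vanish_below i v.

Lemma vanish_below_drop k v : free e -> v \in <<drop k e>>%VS -> vanish_below k v.
Proof.
move=> free_e v_drop i lt_ik.
(* Viewed as a linear form, the coordinate has a kernel subspace, so only the generators need
   checking. *)
suff /subvP/(_ v v_drop) : (<<drop k e>> <= lker (linfun (coord e i : E -> F^o)))%VS.
  by rewrite memv_ker lfunE => /eqP.
apply/span_subvP => w /(nthP 0)[m]; rewrite size_drop size_tuple => lt_m <-.
rewrite memv_ker lfunE /= nth_drop.
have lt_kmn : (k + m < n)%N by rewrite -ltn_subRL.
rewrite (coord_free (Ordinal lt_kmn)) // -val_eqE /=.
by rewrite gtn_eqF // (leq_trans lt_ik) ?leq_addr.
Qed.

Lemma vanish_below_eq0 v : basis_of fullv e -> vanish_below n v -> v = 0.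
Proof.
move=> basis_e v0; rewrite (coord_basis basis_e (memvf v)).
by apply: big1 => i _; rewrite v0 ?scale0r.
Qed.

Lemma exists_leads v : basis_of fullv e -> v != 0 -> exists i, leads i v.
Proof.
move=> basis_e v0.
have [i vi | all0] := pickP (fun i => coord e i v != 0); last first.
  case/eqP: v0; apply: vanish_below_eq0 => // i _.
  by apply/eqP; rewrite -[_ == _]negbK all0.
have [j vj min_j] := @arg_minnP _ i (fun i => coord e i v != 0) val vi.
exists j; split=> // m lt_mj; apply/eqP; apply: contraLR lt_mj => vm.
by rewrite -leqNgt min_j.
Qed.

Section FirstDifference.
Variables (x y : E) (i : 'I_n).
Hypothesis agree : forall j : 'I_n, (j < i)%N -> coord e j x = coord e j y.

(** A witness [j <= i] is impossible: [y] vanishes at [i], and below [i] the two vectors agree. *)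
Lemma not_preceq_first_diff :
  coord e i x != 0 -> coord e i y = 0 -> ~ preceq e x y.
Proof.
move=> xi yi /(_ i xi yi)[j [le_ji xj yj]].
move: le_ji; rewrite leq_eqVlt => /predU1P[/val_inj eq_ji | /agree eq_j].
  by rewrite eq_ji yi eqxx in yj.
by rewrite -eq_j xj eqxx in yj.
Qed.

(** The index [i] is a witness for every [j] in question, since agreement below [i] forces
    [i <= j]. *)
Lemma preceq_first_diff : coord e i x = 0 -> coord e i y != 0 -> preceq e x y.
Proof.
move=> xi yi j xj yj; exists i; split=> //.
by rewrite leqNgt; apply/negP => /agree eq_j; rewrite eq_j yj eqxx in xj.
Qed.

End FirstDifference.

Lemma preceqxx x : preceq e x x.
Proof. by move=> j /eqP. Qed.

Lemma prec_first_diff x y (i : 'I_n) :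
    (forall j : 'I_n, (j < i)%N -> coord e j x = coord e j y) ->
  coord e i x = 0 -> coord e i y != 0 -> prec e x y.
Proof.
move=> agree xi yi; split; first exact: (@preceq_first_diff x y i).
by apply: (@not_preceq_first_diff y x i) => // j /agree.
Qed.

(** With [u = T l x], this is shared by [y = x + u] and [y = exp (T l) x], so the order arguments
    below serve both. *)
Definition agree_upto_lead u x y :=
  forall i, leads i u -> forall j : 'I_n, (j <= i)%N -> coord e j y = coord e j (x + u).

Lemma agree_below_lead u x y (i : 'I_n) :
    agree_upto_lead u x y -> leads i u ->
  forall j : 'I_n, (j < i)%N -> coord e j x = coord e j y.
Proof.
move=> xy lead_i j lt_ji; rewrite (xy i) ?(ltnW lt_ji) // linearD /=.
by rewrite lead_i.2 // addr0.
Qed.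

Lemma prec_of_lead u x y (i : 'I_n) :
  agree_upto_lead u x y -> leads i u -> coord e i x = 0 -> prec e x y.
Proof.
move=> xy lead_i xi; apply: (@prec_first_diff x y i) => //.
  exact: agree_below_lead lead_i.
by rewrite (xy i) // linearD /= xi add0r lead_i.1.
Qed.

Lemma leads_scale (i : 'I_n) (a : F) v : a != 0 -> leads i v -> leads i (a *: v).
Proof.
move=> a0 [vi v0]; split; first by rewrite linearZ /= mulf_neq0.
by move=> j lt_ji; rewrite linearZ /= v0 ?mulr0.
Qed.

Lemma lead_eq0 u x (y : F -> E) (i : 'I_n) :
    (forall a, agree_upto_lead (a *: u) x (y a)) -> (forall a, preceq e x (y a)) ->
  leads i u -> coord e i x = 0.
Proof.
move=> xy le_xy lead_i; apply/eqP/negPn/negP => xi.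
(* This [a] solves [x_i + a u_i = 0]: [y a] first differs from [x] at [i], and vanishes there. *)
pose a := - (coord e i x / coord e i u).
have a0 : a != 0 by rewrite oppr_eq0 mulf_neq0 ?invr_eq0 ?lead_i.1.
have lead_a := leads_scale a0 lead_i.
apply: (not_preceq_first_diff (agree_below_lead (xy a) lead_a) xi _ (le_xy a)).
by rewrite (xy a i) // linearD linearZ /= mulNr divfK ?lead_i.1 // subrr.
Qed.

End Coordinates.

Section Exponential.
Set Implicit Arguments.
Unset Strict Implicit.
Context {F : fieldType} {E : vectType F}.

Lemma lfun_powSr (u : 'End(E)) m v : lfun_pow u m.+1 v = lfun_pow u m (u v).
Proof.
elim: m => [|m IHm]; first by rewrite /= !lfunE /= lfunE.
by rewrite [LHS]lfunE [RHS]lfunE /=; congr (u _).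
Qed.

Lemma lfun_exp_sum (u : 'End(E)) N :
    (forall m, (N <= m)%N -> lfun_pow u m = 0) ->
  lfun_exp u = \sum_(m < N) (m`!)%:R^-1 *: lfun_pow u m.
Proof.
move=> nil_u; rewrite /lfun_exp.
rewrite (fsbig_ord _ N (fun m => (m`!)%:R^-1 *: lfun_pow u m)) /=.
(* Terms of index at least [N] are zero, so the support is finite and the junk value does not
   arise. *)
apply/esym/fsbig_widen => // m [_ /negP]; rewrite -leqNgt => /nil_u um0.
by rewrite /preimage /= um0 scaler0.
Qed.

Context {n : nat} {e : n.-tuple E} (basis_e : basis_of fullv e) (u : 'End(E)).
Hypothesis triangular_u : forall i : 'I_n, u e`_i \in <<drop i.+1 e>>%VS.

(** In the expansion of [v], the terms with [i < k] have coefficient 0, and for [i >= k] the image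
    of [e_i] involves only [e_j] with [j > i >= k]. *)
Lemma vanish_below_triangular k v : vanish_below e k v -> vanish_below e k.+1 (u v).
Proof.
move=> v0 j le_jk; rewrite (coord_basis basis_e (memvf v)) !linear_sum /=.
apply: big1 => i _; rewrite !linearZ /=.
have [lt_ik | le_ki] := ltnP i k; first by rewrite v0 ?mul0r.
rewrite (vanish_below_drop (basis_free basis_e) (triangular_u i)) ?mulr0 //.
exact: leq_trans le_jk _.
Qed.

Lemma vanish_below_pow k m v :
  vanish_below e k v -> vanish_below e (m + k) (lfun_pow u m v).
Proof.
move=> v0; elim: m => [|m IHm]; first by rewrite /= lfunE.
by rewrite /= lfunE; apply: vanish_below_triangular.
Qed.

Lemma lfun_pow_eq0 m : (n <= m)%N -> lfun_pow u m = 0.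
Proof.
move=> le_nm; apply/lfunP => v; rewrite lfunE /=.
apply: (vanish_below_eq0 basis_e) => i _.
(* For [k = 0] the assumption on [v] is vacuous. *)
by apply: (@vanish_below_pow 0 m v) => //; rewrite addn0 (leq_trans _ le_nm).
Qed.

Lemma lfun_exp_expand v :
  lfun_exp u v = v + u v + \sum_(m < n) (m.+2`!)%:R^-1 *: lfun_pow u m.+1 (u v).
Proof.
(* The bound [n.+2] allows two terms to be split off whatever [n] is. *)
rewrite (@lfun_exp_sum u n.+2); last first.
  by move=> m le_m; apply: lfun_pow_eq0; rewrite (leq_trans _ le_m) // ltnW.
rewrite !big_ord_recl /= /bump /= !fact0 invr1 !scale1r addrA.
rewrite !lfunE /= lfunE /= !lfunE /= lfunE /=; congr (_ + _).
rewrite sum_lfunE; apply: eq_bigr => m _.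
by rewrite !add1n lfunE /= -(lfun_powSr u m.+1).
Qed.

Lemma lfun_exp_fix v : u v = 0 -> lfun_exp u v = v.
Proof.
move=> uv0; rewrite lfun_exp_expand uv0 addr0 big1 ?addr0 // => m _.
by rewrite linear0 scaler0.
Qed.

(** If [u v] leads at [i], the terms after [v + u v] vanish below [m + 1 + i], hence also at [i]
    itself. *)
Lemma lfun_exp_agree v : agree_upto_lead e (u v) v (lfun_exp u v).
Proof.
move=> i [_ uv0] j le_ji; rewrite lfun_exp_expand linearD /= linear_sum /=.
rewrite big1 ?addr0 // => m _; rewrite linearZ /=.
rewrite (@vanish_below_pow i m.+1 _ uv0) ?mulr0 //.
by rewrite addSn ltnS (leq_trans le_ji) ?leq_addl.
Qed.

End Exponential.

Theorem theorem2 (f : fieldType) (char_f : [pchar f] =i pred0)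
  (L : lieAlgType f) (E : vectType f)
  (n : nat) (e : n.-tuple E) (basis_e : basis_of fullv e)
  (T : {linear L -> 'End(E)}) (repr_T : lie_representation T)
  (triangular_T : strictly_triangular e T) (x : E) :
  normal_form e (Gamma_orbit T x) x <-> forall l : L, preceq e x (x + T l x).
Proof.
have orbit_exp l : Gamma_orbit T x (lfun_exp (T l) x).
  by exists (lfun_exp (T l)) => //; exists l.
have TZ a l : T (a *: l) x = a *: T l x by rewrite linearZ lfunE.
split=> [[_ min_x] l | le_x].
  have [-> | /(exists_leads basis_e)[i lead_i]] := eqVneq (T l x) 0.
    by rewrite addr0; apply: preceqxx.
  have agree a : agree_upto_lead e (a *: T l x) x (lfun_exp (T (a *: l)) x).
    by rewrite -TZ; apply: lfun_exp_agree.
  have le_exp a : preceq e x (lfun_exp (T (a *: l)) x).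
    have [-> | /eqP ne_x] := eqVneq (lfun_exp (T (a *: l)) x) x.
      exact: preceqxx.
    by case: (min_x _ (orbit_exp _) ne_x).
  (* Minimality of [x] is used against the orbit points given by all multiples of [l], not just
     [l]. *)
  have xi := lead_eq0 agree le_exp lead_i.
  by case: (prec_of_lead (y := x + T l x) _ lead_i xi).
(* The point [x] lies in its own orbit through [l = 0]. *)
split; first by rewrite -{2}(@lfun_exp_fix _ _ _ _ basis_e (T 0) _ x) // linear0 lfunE.
move=> _ [_ [l _ <-] <-] ne_x.
have Tlx0 : T l x != 0.
  by apply/eqP => Tlx; apply: ne_x; apply: (lfun_exp_fix basis_e).
have [i lead_i] := exists_leads basis_e Tlx0.
apply: (prec_of_lead (@lfun_exp_agree _ _ _ _ basis_e _ (triangular_T l) x) lead_i).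
(* Here the family is [x + a T l x], whose agreement condition is an identity; [preceq] is the
   hypothesis at [a *: l]. *)
apply: (@lead_eq0 _ _ _ e (T l x) x (fun a => x + a *: T l x)) => // a.
by rewrite -TZ.
Qed.
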